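(* Let $\mathcal{A} \in \mathbb{C}^{I_1\times\cdots\times I_M \times J_1\times\cdots\times J_N}$ and $\mathcal{B} \in \mathbb{C}^{J_1\times\cdots\times J_N \times K_1\times\cdots\times K_L}$. Let $\mathcal{M} \in \mathbb{C}^{I_1\times\cdots\times I_M \times I_1 \times\cdots\times I_M}$, $\mathcal{N} \in \mathbb{C}^{K_1\times\cdots\times K_L \times K_1 \times\cdots\times K_L}$ and $\mathcal{P} \in \mathbb{C}^{J_1\times\cdots\times J_N \times J_1 \times\cdots\times J_N}$ be three Hermitian positive definite tensors. Then $$(\mathcal{A}*_N\mathcal{B})_{\mathcal{M},\mathcal{N}} ^\dagger = \mathcal{B}_{\mathcal{P},\mathcal{N}}^\dagger *_N\mathcal{A}_{\mathcal{M},\mathcal{P}}^\dagger$$ if and only if $$\mathfrak{R}(\mathcal{A}^{\#}_{\mathcal{P},\mathcal{M}}*_M\mathcal{A}*_N\mathcal{B}) \subseteq \mathfrak{R}(\mathcal{B})\quad\text{and}\quad \mathfrak{R}(\mathcal{B}*_L\mathcal{B}^{\#}_{\mathcal{N},\mathcal{P}}*_N\mathcal{A}^{\#}_{\mathcal{P},\mathcal{M}}) \subseteq \mathfrak{R}(\mathcal{A}^{\#}_{\mathcal{P},\mathcal{M}}).$$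
   Context: Einstein product: for $\mathcal{A}\in\mathbb{C}^{I_1\times\cdots\times I_M\times J_1\times\cdots\times J_N}$ and $\mathcal{B}\in\mathbb{C}^{J_1\times\cdots\times J_N\times K_1\times\cdots\times K_L}$, $(\mathcal{A}*_N\mathcal{B})_{i_1\ldots i_Mk_1\ldots k_L}=\sum_{j_1,\ldots,j_N}a_{i_1\ldots i_Mj_1\ldots j_N}b_{j_1\ldots j_Nk_1\ldots k_L}$ (the subscript is the number of contracted indices; similarly $*_M,*_L$). The conjugate transpose $\mathcal{A}^*$ has entries $(\mathcal{A}^* )_{j_1\ldots j_Ni_1\ldots i_M}=\overline{a_{i_1\ldots i_Mj_1\ldots j_N}}$. The range of $\mathcal{A}\in\mathbb{C}^{I_1\times\cdots\times I_M\times J_1\times\cdots\times J_N}$ is $\mathfrak{R}(\mathcal{A})=\{\mathcal{A}*_N\mathcal{X}:\mathcal{X}\in\mathbb{C}^{J_1\times\cdots\times J_N}\}$. Inverses of tensors with the same row and column index sets are with respect to the Einstein product (identity tensors have entries equal to products of Kronecker deltas). A tensor $\mathcal{Q}$ with the same row and column index sets is Hermitian positive definite if $\mathcal{Q}=\mathcal{Z}*\mathcal{D}*\mathcal{Z}^*$ (Einstein products over all the row indices) with $\mathcal{Z}$ unitary ($\mathcal{Z}*\mathcal{Z}^*=\mathcal{Z}^**\mathcal{Z}$ is the identity tensor) and $\mathcal{D}$ a diagonal tensor with positive diagonal entries. Weighted Moore-Penrose inverse: for $\mathcal{A}\in\mathbb{C}^{I_1\times\cdots\times I_M\times J_1\times\cdots\times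 J_N}$ and Hermitian positive definite $\mathcal{M}$ (on $I_1\times\cdots\times I_M$) and $\mathcal{P}$ (on $J_1\times\cdots\times J_N$), $\mathcal{A}^\dagger_{\mathcal{M},\mathcal{P}}$ is the unique $\mathcal{Y}\in\mathbb{C}^{J_1\times\cdots\times J_N\times I_1\times\cdots\times I_M}$ with $\mathcal{A}*_N\mathcal{Y}*_M\mathcal{A}=\mathcal{A}$, $\mathcal{Y}*_M\mathcal{A}*_N\mathcal{Y}=\mathcal{Y}$, $(\mathcal{M}*_M\mathcal{A}*_N\mathcal{Y})^*=\mathcal{M}*_M\mathcal{A}*_N\mathcal{Y}$, $(\mathcal{P}*_N\mathcal{Y}*_M\mathcal{A})^*=\mathcal{P}*_N\mathcal{Y}*_M\mathcal{A}$; similarly for other index sets. Weighted conjugate transposes: $\mathcal{A}^{\#}_{\mathcal{P},\mathcal{M}}=\mathcal{P}^{-1}*_N\mathcal{A}^**_M\mathcal{M}$ and $\mathcal{B}^{\#}_{\mathcal{N},\mathcal{P}}=\mathcal{N}^{-1}*_L\mathcal{B}^**_N\mathcal{P}$. *)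

(* Defs.v *)
From HB Require Import structures.
From mathcomp Require Import all_boot all_order all_algebra.
From mathcomp Require Import complex.
From mathcomp Require Import boolp classical_sets reals.

Set Implicit Arguments.
Unset Strict Implicit.
Unset Printing Implicit Defensive.

Import Order.TTheory GRing.Theory Num.Theory.

Local Open Scope classical_set_scope.
Local Open Scope ring_scope.

(* Multi-indices (i_1, ..., i_m) of a shape I_1 x ... x I_m, 0-based. *)
Definition midx (m : nat) (I : 'I_m -> nat) := {dffun forall k : 'I_m, 'I_(I k)}.

(* C^{J_1 x ... x J_n} *)
Definition tensor (R : realType) (n : nat) (J : 'I_n -> nat) :=
  {ffun midx J -> R[i]}.

(* C^{I_1 x ... x I_m x J_1 x ... x J_n}; the split between row and column
   indices is part of the type, so it determines which indices each Einstein
   product contracts. *)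
Definition btensor (R : realType) (m n : nat) (I : 'I_m -> nat) (J : 'I_n -> nat) :=
  {ffun midx I * midx J -> R[i]}.

Section Operations.
Variable R : realType.

Definition einstein (m n l : nat) (I : 'I_m -> nat) (J : 'I_n -> nat)
    (K : 'I_l -> nat) (A : btensor R I J) (B : btensor R J K) : btensor R I K :=
  [ffun ik => \sum_(j : midx J) A (ik.1, j) * B (j, ik.2)].

(* The Einstein product in the case where the right factor has no column index. *)
Definition einstein1 (m n : nat) (I : 'I_m -> nat) (J : 'I_n -> nat)
    (A : btensor R I J) (X : tensor R J) : tensor R I :=
  [ffun i => \sum_(j : midx J) A (i, j) * X j].

Definition ctrans (m n : nat) (I : 'I_m -> nat) (J : 'I_n -> nat)
    (A : btensor R I J) : btensor R J I :=
  [ffun ji => conjc (A (ji.2, ji.1))].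

(* Equality of multi-indices is componentwise, so this entry is the product of
   the Kronecker deltas of the components. *)
Definition idt (m : nat) (I : 'I_m -> nat) : btensor R I I :=
  [ffun ij => (ij.1 == ij.2)%:R].

Definition trange (m n : nat) (I : 'I_m -> nat) (J : 'I_n -> nat)
    (A : btensor R I J) : set (tensor R I) :=
  range (einstein1 A).

End Operations.

Notation "A *E B" := (einstein A B) (at level 40, left associativity).

Section Weighted.
Variable R : realType.

(* Defaults to 0 when A is not invertible. *)
Definition tinv (m : nat) (I : 'I_m -> nat) (A : btensor R I I) : btensor R I I :=
  xget 0 [set X : btensor R I I | A *E X = idt R I /\ X *E A = idt R I].

Definition unitary (m : nat) (I : 'I_m -> nat) (Z : btensor R I I) : Prop :=
  Z *E ctrans Z = idt R I /\ ctrans Z *E Z = idt R I.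

(* In the order on R[i], 0 < z means that z is real and positive. *)
Definition pos_diagonal (m : nat) (I : 'I_m -> nat) (D : btensor R I I) : Prop :=
  (forall i j : midx I, i <> j -> D (i, j) = 0) /\
  (forall i : midx I, 0 < D (i, i)).

Definition herm_posdef (m : nat) (I : 'I_m -> nat) (Q : btensor R I I) : Prop :=
  exists Z D : btensor R I I,
    [/\ unitary Z, pos_diagonal D & Q = Z *E D *E ctrans Z].

Definition is_wmpinv (m n : nat) (I : 'I_m -> nat) (J : 'I_n -> nat)
    (M : btensor R I I) (P : btensor R J J) (A : btensor R I J)
    (Y : btensor R J I) : Prop :=
  [/\ A *E Y *E A = A,
      Y *E A *E Y = Y,
      ctrans (M *E A *E Y) = M *E A *E Y
    & ctrans (P *E Y *E A) = P *E Y *E A].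

(* For Hermitian positive definite weights there is exactly one Y satisfying
   is_wmpinv M P A; the default 0 matters only for other weights. *)
Definition wmpinv (m n : nat) (I : 'I_m -> nat) (J : 'I_n -> nat)
    (M : btensor R I I) (P : btensor R J J) (A : btensor R I J) : btensor R J I :=
  xget 0 [set Y | is_wmpinv M P A Y].

Definition wctrans (m n : nat) (I : 'I_m -> nat) (J : 'I_n -> nat)
    (P : btensor R J J) (M : btensor R I I) (A : btensor R I J) : btensor R J I :=
  tinv P *E ctrans A *E M.

End Weighted.

(* Main.v *)
(* Write X# for the weighted conjugate transpose.  It is an involutive
   anti-automorphism with X# X = 0 only for X = 0, and the weighted
   Moore-Penrose equations say that AY and YA are #-selfadjoint idempotents, so
   Greville's argument for matrices applies.  Put F = B B^+ and E = A^+ A.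
   The two inclusions say that F commutes with A# A and E with B B#; this makes
   E and F commute and A F A^+, B^+ E B selfadjoint, so B^+ A^+ satisfies the
   equations for A B.  Conversely, (AB)# = (AB)# (AB) B^+ A^+ yields
   F A# A (1 - F) A# A F = 0, that is (1 - F) A# A F = 0.  The second inclusion
   is the first one for the pair (B#, A#). *)
Require Import Defs.
From mathcomp Require Import all_boot all_order all_algebra.
From mathcomp Require Import complex.
From mathcomp Require Import boolp classical_sets reals.

Set Implicit Arguments.
Unset Strict Implicit.
Unset Printing Implicit Defensive.

Import Order.TTheory GRing.Theory Num.Theory.

Local Open Scope classical_set_scope.

Section EinsteinAlgebra.
Local Open Scope ring_scope.
Variable R : realType.

(** * Algebra of the Einstein product and the conjugate transpose *)

Section Products.
Context {m n l p : nat} {I : 'I_m -> nat} {J : 'I_n -> nat} {K : 'I_l -> nat}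
  {L : 'I_p -> nat}.

Lemma einsteinA (A : btensor R I J) (B : btensor R J K) (C : btensor R K L) :
  A *E (B *E C) = A *E B *E C.
Proof.
apply/ffunP=> -[i k]; rewrite !ffunE /=.
under eq_bigr do rewrite ffunE /= mulr_sumr.
under [RHS]eq_bigr do rewrite ffunE /= mulr_suml.
rewrite exchange_big; apply: eq_bigr => j _; apply: eq_bigr => q _.
by rewrite mulrA.
Qed.

Lemma einstein1A (A : btensor R I J) (B : btensor R J K) (X : tensor R K) :
  einstein1 A (einstein1 B X) = einstein1 (A *E B) X.
Proof.
apply/ffunP=> i; rewrite !ffunE /=.
under eq_bigr do rewrite ffunE /= mulr_sumr.
under [RHS]eq_bigr do rewrite ffunE /= mulr_suml.
rewrite exchange_big; apply: eq_bigr => j _; apply: eq_bigr => q _.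
by rewrite mulrA.
Qed.

Lemma idt_einstein (A : btensor R I J) : idt R I *E A = A.
Proof.
apply/ffunP=> -[i k]; rewrite !ffunE /= (bigD1 i) //= ffunE /= eqxx mul1r.
rewrite big1 ?addr0 // => j /negPf ji.
by rewrite ffunE /= eq_sym ji mul0r.
Qed.

Lemma einstein_idt (A : btensor R I J) : A *E idt R J = A.
Proof.
apply/ffunP=> -[i k]; rewrite !ffunE /= (bigD1 k) //= ffunE /= eqxx mulr1.
rewrite big1 ?addr0 // => j /negPf jk.
by rewrite ffunE /= jk mulr0.
Qed.

Lemma einsteinBl (A B : btensor R I J) (C : btensor R J K) :
  (A - B) *E C = A *E C - B *E C.
Proof.
apply/ffunP=> ik; rewrite !ffunE -sumrB.
by apply: eq_bigr => j _; rewrite !ffunE mulrBl.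
Qed.

Lemma einsteinBr (A : btensor R I J) (B C : btensor R J K) :
  A *E (B - C) = A *E B - A *E C.
Proof.
apply/ffunP=> ik; rewrite !ffunE -sumrB.
by apply: eq_bigr => j _; rewrite !ffunE mulrBr.
Qed.

Lemma einstein0 (A : btensor R I J) : A *E (0 : btensor R J K) = 0.
Proof. by rewrite -(subrr 0) einsteinBr subrr. Qed.

Lemma ctransM (A : btensor R I J) (B : btensor R J K) :
  ctrans (A *E B) = ctrans B *E ctrans A.
Proof.
apply/ffunP=> -[k i]; rewrite !ffunE /= rmorph_sum.
by apply: eq_bigr => j _; rewrite !ffunE /= rmorphM mulrC.
Qed.

Lemma ctransK (A : btensor R I J) : ctrans (ctrans A) = A.
Proof. by apply/ffunP=> -[i j]; rewrite !ffunE /= conjcK. Qed.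

End Products.

Lemma ctrans_idt m (I : 'I_m -> nat) : ctrans (idt R I) = idt R I.
Proof.
apply/ffunP=> -[i j]; rewrite !ffunE /= eq_sym.
by case: eqP; rewrite ?conjc1 ?conjc0.
Qed.

(** Enumerating the multi-indices flattens [A] to a matrix, whose [pinvmx] is an inner inverse. *)
Lemma einstein_inner_inverse m n (I : 'I_m -> nat) (J : 'I_n -> nat)
    (A : btensor R I J) : exists X : btensor R J I, A *E X *E A = A.
Proof.
pose a := \matrix_(i < #|midx I|, j < #|midx J|) A (enum_val i, enum_val j).
have [x axa] : exists x : 'M_(#|midx J|, #|midx I|), a *m x *m a = a.
  by exists (pinvmx a); rewrite mulmxKpV.
exists [ffun ji => x (enum_rank ji.1) (enum_rank ji.2)].
apply/ffunP=> -[i j]; rewrite ffunE /=.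
have /matrixP/(_ (enum_rank i) (enum_rank j)) := axa.
rewrite !mxE !enum_rankK => <-.
rewrite [RHS](reindex (@enum_rank _)) /=; last first.
  by apply: onW_bij; exact: enum_rank_bij.
apply: eq_bigr => u _; rewrite !mxE !ffunE /= !enum_rankK; congr (_ * _).
rewrite [RHS](reindex (@enum_rank _)) /=; last first.
  by apply: onW_bij; exact: enum_rank_bij.
by apply: eq_bigr => v _; rewrite !mxE !ffunE /= !enum_rankK.
Qed.

Lemma trange_einstein m n l (I : 'I_m -> nat) (J : 'I_n -> nat)
    (K : 'I_l -> nat) (A : btensor R I J) (X : btensor R J K) :
  trange (A *E X) `<=` trange A.
Proof.
by move=> _ [x _ <-]; exists (einstein1 X x) => //; rewrite einstein1A.
Qed.

(** [A *E G] is an idempotent with the same range as [A]. This turns both range inclusions of the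
    theorem into identities. *)
Lemma trange_subP m n l (I : 'I_m -> nat) (J : 'I_n -> nat)
    (K : 'I_l -> nat) (A : btensor R I J) (G : btensor R J I)
    (B : btensor R I K) :
  A *E G *E A = A -> trange B `<=` trange A <-> A *E G *E B = B.
Proof.
move=> AGA; split=> [sBA|<-]; last first.
  by rewrite -einsteinA; exact: trange_einstein.
apply/ffunP=> -[i k].
(* Applying a tensor to the unit tensor [e] extracts its column [k]. *)
pose e : tensor R K := [ffun q => (q == k)%:R].
have colE (C : btensor R I K) (q : midx I) : einstein1 C e q = C (q, k).
  rewrite ffunE (bigD1 k) //= ffunE eqxx mulr1 big1 ?addr0 // => j /negPf jk.
  by rewrite ffunE jk mulr0.
have [|x _ xE] := sBA (einstein1 B e); first by exists e.
by rewrite -!colE -einstein1A -xE einstein1A AGA.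
Qed.

(** * Hermitian positive definite weights *)

Section PositiveDefinite.
Context {m : nat} {I : 'I_m -> nat} {Q : btensor R I I}.
Hypothesis hQ : herm_posdef Q.

Lemma herm_posdef_ctrans : ctrans Q = Q.
Proof.
have [Z [D [_ [D0 Dgt0] ->]]] := hQ; rewrite !ctransM ctransK einsteinA.
congr (_ *E _ *E _); apply/ffunP=> -[i j]; rewrite ffunE /=.
have [<-|/eqP ij] := eqVneq i j; last by rewrite !D0 ?rmorph0 // => /esym.
exact/CrealP/gtr0_real.
Qed.

Lemma herm_posdef_inverse : exists X, Q *E X = idt R I /\ X *E Q = idt R I.
Proof.
have [Z [D [[ZZ' Z'Z] [D0 Dgt0] ->]]] := hQ.
(* Off the diagonal the numerator is 0, so dividing by a zero entry of [D] does no harm. *)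
pose D' : btensor R I I := [ffun ij => (ij.1 == ij.2)%:R / D ij].
have DD' : D *E D' = idt R I.
  apply/ffunP=> -[i j]; rewrite !ffunE /= (bigD1 i) //= big1 ?addr0; last first.
    by move=> q /eqP qi; rewrite D0 ?mul0r // => /esym.
  rewrite ffunE /=; have [<-|_] := eqVneq i j; last by rewrite mul0r mulr0.
  by rewrite mul1r divff // gt_eqF.
have D'D : D' *E D = idt R I.
  apply/ffunP=> -[i j]; rewrite !ffunE /= (bigD1 j) //= big1 ?addr0; last first.
    by move=> q /eqP qj; rewrite D0 ?mulr0.
  rewrite ffunE /=; have [<-|_] := eqVneq i j; last by rewrite !mul0r.
  by rewrite mul1r mulVf // gt_eqF.
exists (Z *E D' *E ctrans Z); split.
  rewrite !einsteinA -(einsteinA _ (ctrans Z)) Z'Z einstein_idt.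
  by rewrite -(einsteinA Z) DD' einstein_idt.
rewrite !einsteinA -(einsteinA _ (ctrans Z)) Z'Z einstein_idt.
by rewrite -(einsteinA Z) D'D einstein_idt.
Qed.

Lemma einstein_tinv : Q *E tinv Q = idt R I.
Proof.
rewrite /tinv; case: xgetP => [X _ []//|noX].
by have [X /noX] := herm_posdef_inverse.
Qed.

Lemma tinv_einstein : tinv Q *E Q = idt R I.
Proof.
rewrite /tinv; case: xgetP => [X _ []//|noX].
by have [X /noX] := herm_posdef_inverse.
Qed.

Lemma ctrans_tinv : ctrans (tinv Q) = tinv Q.
Proof.
rewrite -[LHS]einstein_idt -einstein_tinv -{2}herm_posdef_ctrans einsteinA.
by rewrite -ctransM einstein_tinv ctrans_idt idt_einstein.
Qed.

(** With [W] the product of [ctrans Z] and [A], a diagonal entry of the Gram tensor is a sum of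
    terms [D (q, q) * |W (q, k)|^2]. These are nonnegative, so each of them vanishes. *)
Lemma herm_posdef_gram_eq0 n (J : 'I_n -> nat) (A : btensor R I J) :
  ctrans A *E Q *E A = 0 -> A = 0.
Proof.
have [Z [D [[ZZ' Z'Z] [D0 Dgt0] ->]]] := hQ => AQA0.
pose W := ctrans Z *E A.
suff W0 : W = 0 by rewrite -[A]idt_einstein -ZZ' -einsteinA -/W W0 einstein0.
have WDW0 : ctrans W *E D *E W = 0.
  by rewrite -AQA0 /W ctransM ctransK !einsteinA.
apply/ffunP=> -[i k]; rewrite [RHS]ffunE.
have term q : (ctrans W *E D) (k, q) = D (q, q) * (W (q, k))^*%C.
  rewrite !ffunE /= (bigD1 q) //= big1 ?addr0 ?ffunE 1?mulrC //.
  by move=> j /eqP jq; rewrite D0 ?mulr0.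
have := congr1 (fun X : btensor R J J => X (k, k)) WDW0.
rewrite ffunE [RHS]ffunE /=.
under eq_bigr do rewrite term -mulrA.
move/eqP; rewrite psumr_eq0 => [|q _]; last first.
  by rewrite mulr_ge0 ?(ltW (Dgt0 _)) // mulrC mul_conjC_ge0.
move=> /allP/(_ i (mem_index_enum _)) /=.
by rewrite mulf_eq0 (gt_eqF (Dgt0 _)) /= mulrC mul_conjC_eq0 => /eqP.
Qed.

End PositiveDefinite.

(* Locked, since [einsteinA] would unfold [wctrans] when matching products. *)
Definition wadj m n (I : 'I_m -> nat) (J : 'I_n -> nat)
    (P : btensor R J J) (M : btensor R I I) (A : btensor R I J) :
  btensor R J I := locked (wctrans P M A).

Lemma wctrans_wadj m n (I : 'I_m -> nat) (J : 'I_n -> nat) (P : btensor R J J)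
    (M : btensor R I I) (A : btensor R I J) :
  wctrans P M A = wadj P M A.
Proof. exact: lock. Qed.

Lemma wadjE m n (I : 'I_m -> nat) (J : 'I_n -> nat) (P : btensor R J J)
    (M : btensor R I I) (A : btensor R I J) :
  wadj P M A = tinv P *E ctrans A *E M.
Proof. by rewrite -wctrans_wadj. Qed.

(** * The weighted adjoint as an involution *)

Section WeightedTranspose.
Context {m n : nat} {I : 'I_m -> nat} {J : 'I_n -> nat}
  {M : btensor R I I} {P : btensor R J J}.
Hypotheses (hM : herm_posdef M) (hP : herm_posdef P).

Lemma wadjK (A : btensor R I J) : wadj M P (wadj P M A) = A.
Proof.
rewrite !wadjE !ctransM ctransK (ctrans_tinv hP) (herm_posdef_ctrans hM).
rewrite !einsteinA (tinv_einstein hM) idt_einstein -einsteinA.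
by rewrite (tinv_einstein hP) einstein_idt.
Qed.

(** The inner factors [P] and [tinv P] cancel, since both adjoints carry the same weight on [J]. *)
Lemma wadjM l (K : 'I_l -> nat) (N : btensor R K K)
    (A : btensor R I J) (B : btensor R J K) :
  wadj N M (A *E B) = wadj N P B *E wadj P M A.
Proof.
rewrite !wadjE ctransM !einsteinA -[tinv N *E ctrans B *E P *E tinv P]einsteinA.
by rewrite (einstein_tinv hP) einstein_idt.
Qed.

Lemma wadjB (A B : btensor R I J) :
  wadj P M (A - B) = wadj P M A - wadj P M B.
Proof.
rewrite !wadjE.
have -> : ctrans (A - B) = ctrans A - ctrans B.
  by apply/ffunP=> ji; rewrite !ffunE rmorphB.
by rewrite einsteinBr einsteinBl.
Qed.

Lemma wadj_gram_eq0 (A : btensor R I J) : wadj P M A *E A = 0 -> A = 0.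
Proof.
move=> AA0; apply: (herm_posdef_gram_eq0 hM).
rewrite -[LHS]idt_einstein -(einstein_tinv hP) -einsteinA.
have -> : tinv P *E (ctrans A *E M *E A) = 0 by rewrite -AA0 wadjE !einsteinA.
by rewrite einstein0.
Qed.

(** The adjoint absorbs the weight of the Hermitian conditions in [is_wmpinv], so the unweighted
    argument can be followed with [wadj] as the star. *)
Lemma ctrans_wadjP (A : btensor R I I) :
  ctrans (M *E A) = M *E A <-> wadj M M A = A.
Proof.
rewrite ctransM (herm_posdef_ctrans hM) !wadjE; split=> [MA|{2}<-].
  by rewrite -einsteinA MA einsteinA (tinv_einstein hM) idt_einstein.
by rewrite !einsteinA (einstein_tinv hM) idt_einstein.
Qed.

End WeightedTranspose.

(** For rewriting a factor inside a left-associated product. *)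
Lemma einstein_mull m n l p (I : 'I_m -> nat) (J : 'I_n -> nat)
    (K : 'I_l -> nat) (L : 'I_p -> nat) (B : btensor R J K) (C : btensor R K L)
    (D : btensor R J L) :
  B *E C = D -> forall A : btensor R I J, A *E B *E C = A *E D.
Proof. by move=> BC A; rewrite -einsteinA BC. Qed.

Lemma einstein_mulll m n l p q (I : 'I_m -> nat) (J : 'I_n -> nat)
    (K : 'I_l -> nat) (L : 'I_p -> nat) (S : 'I_q -> nat) (B : btensor R J K)
    (C : btensor R K L) (D : btensor R L S) (E : btensor R J S) :
  B *E C *E D = E -> forall A : btensor R I J, A *E B *E C *E D = A *E E.
Proof. by move=> BCD A; rewrite -BCD !einsteinA. Qed.

(** The hypothesis makes the weighted Gram tensor of [A *E (U - V)] vanish. *)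
Lemma wadj_cancel m n l (I : 'I_m -> nat) (J : 'I_n -> nat)
    (K : 'I_l -> nat) (M : btensor R I I) (P : btensor R J J) (N : btensor R K K)
    (A : btensor R I J) (U V : btensor R J K) :
    herm_posdef M -> herm_posdef P -> herm_posdef N ->
  wadj P M A *E A *E U = wadj P M A *E A *E V -> A *E U = A *E V.
Proof.
move=> hM hP hN AAUV; apply/eqP; rewrite -subr_eq0 -einsteinBr; apply/eqP.
apply: (wadj_gram_eq0 hM hN); rewrite (wadjM hP) !einsteinA.
rewrite -(einsteinA _ _ A) -(einsteinA _ _ (U - V)).
by rewrite einsteinBr AAUV subrr einstein0.
Qed.

(** * Existence and uniqueness of the weighted Moore-Penrose inverse *)

Section MoorePenrose.
Context {m n : nat} {I : 'I_m -> nat} {J : 'I_n -> nat}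
  {M : btensor R I I} {P : btensor R J J}.
Hypotheses (hM : herm_posdef M) (hP : herm_posdef P).

Lemma is_wmpinvE (A : btensor R I J) (Y : btensor R J I) :
  is_wmpinv M P A Y <->
  [/\ A *E Y *E A = A, Y *E A *E Y = Y,
      wadj M M (A *E Y) = A *E Y & wadj P P (Y *E A) = Y *E A].
Proof.
rewrite /is_wmpinv -!(einsteinA M) -!(einsteinA P).
by split=> -[-> -> /ctrans_wadjP ? /ctrans_wadjP ?]; split=> //; auto.
Qed.

Lemma is_wmpinv_unique (A : btensor R I J) (Y Z : btensor R J I) :
  is_wmpinv M P A Y -> is_wmpinv M P A Z -> Y = Z.
Proof.
case/is_wmpinvE=> AYA YAY AYh YAh /is_wmpinvE[AZA ZAZ AZh ZAh].
(* Taking adjoints in [AY = (AZ)(AY)] gives [AY = (AY)(AZ) = AZ]. *)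
have AYZ : A *E Y = A *E Z.
  by rewrite -AYh -{1}AZA -einsteinA (wadjM hM) AZh AYh einsteinA AYA.
have YZA : Y *E A = Z *E A.
  by rewrite -YAh -{1}AZA !einsteinA -einsteinA (wadjM hP) ZAh YAh -einsteinA
    (einsteinA A) AYA.
by rewrite -YAY YZA -einsteinA AYZ einsteinA ZAZ.
Qed.

(* If X is an inner inverse of the Gram tensor A# A, then X A# satisfies the
   first and third Moore-Penrose equations. *)
Lemma is_winv13_exists (A : btensor R I J) : exists Y : btensor R J I,
  A *E Y *E A = A /\ wadj M M (A *E Y) = A *E Y.
Proof.
have [X GXG] := einstein_inner_inverse (wadj P M A *E A).
set A' := wadj P M A in GXG; pose X' := wadj P P X.
have Gh : wadj P P (A' *E A) = A' *E A by rewrite (wadjM hM) wadjK.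
have inner U : A' *E A *E U *E (A' *E A) = A' *E A ->
    A *E (U *E A') *E A = A.
  move=> GUG; rewrite -[RHS]einstein_idt -!einsteinA.
  apply: (wadj_cancel hM hP hP); rewrite -/A' einstein_idt -[RHS]GUG.
  by rewrite !einsteinA.
have AXA := inner X GXG.
(* The Gram tensor is selfadjoint, so the adjoint [X'] of [X] is an inner inverse of it too. *)
have AX'A : A *E (X' *E A') *E A = A.
  apply: inner; rewrite -{1 2}Gh -einsteinA -!(wadjM hP).
  by rewrite GXG.
exists (X *E A'); split=> //.
have adj : wadj M M (A *E (X *E A')) = A *E (X' *E A').
  by rewrite !(wadjM hP) wadjK // einsteinA.
rewrite adj.
(* For [S = A X A'] with adjoint [S#], the product [S S#] is selfadjoint and equals [S#] by [AXA];
   hence [S = S#]. *)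
have self : wadj M M (A *E (X *E A') *E (A *E (X' *E A')))
    = A *E (X *E A') *E (A *E (X' *E A')).
  by rewrite -adj (wadjM hM) (wadjK hM hM).
have AXX' : A *E (X *E A') *E (A *E (X' *E A')) = A *E (X' *E A').
  by rewrite [LHS]einsteinA AXA.
by rewrite -[LHS]AXX' -self AXX' -adj (wadjK hM hM).
Qed.

End MoorePenrose.

(** The adjoint reverses products, so it preserves the first two equations and exchanges the last
    two. *)
Lemma is_wmpinv_wadj m n (I : 'I_m -> nat) (J : 'I_n -> nat)
    (M : btensor R I I) (P : btensor R J J) (A : btensor R I J)
    (Y : btensor R J I) : herm_posdef M -> herm_posdef P ->
  is_wmpinv M P A Y -> is_wmpinv P M (wadj P M A) (wadj M P Y).
Proof.
move=> hM hP /(is_wmpinvE hM hP)[AYA YAY AYh YAh]; apply/(is_wmpinvE hP hM).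
rewrite -(wadjM hM) -!(wadjM hP) -(wadjM hM) !einsteinA AYA YAY.
by rewrite AYh YAh.
Qed.

(** Urquhart's formula [Z A Y]: [Y] satisfies the first and third equations, [Z] the first and
    fourth. [Z] is the adjoint of a solution of the first and third for the adjoint of [A]. *)
Lemma is_wmpinv_exists m n (I : 'I_m -> nat) (J : 'I_n -> nat)
    (M : btensor R I I) (P : btensor R J J) (A : btensor R I J) :
  herm_posdef M -> herm_posdef P -> exists Y, is_wmpinv M P A Y.
Proof.
move=> hM hP; have [Y [AYA AYh]] := is_winv13_exists hM hP A.
have [Z' [AZA' AZh]] := is_winv13_exists hP hM (wadj P M A).
pose Z := wadj P M Z'.
have Z'E : Z' = wadj M P Z by rewrite (wadjK hM hP).
have AZA : A *E Z *E A = A.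
  apply: (can_inj (wadjK hM hP)).
  by rewrite -einsteinA (wadjM hP) (wadjM hM) -Z'E.
have ZAh : wadj P P (Z *E A) = Z *E A.
  have <- : wadj P P (wadj P M A *E Z') = Z *E A.
    by rewrite (wadjM hM) (wadjK hM hP).
  by rewrite AZh.
exists (Z *E A *E Y); apply/(is_wmpinvE hM hP).
have AW : A *E (Z *E A *E Y) = A *E Y by rewrite !einsteinA AZA.
have WA : Z *E A *E Y *E A = Z *E A by rewrite -2!einsteinA (einsteinA A) AYA.
by rewrite AW WA; split=> //; rewrite -(einsteinA Z) AW einsteinA.
Qed.

Lemma wmpinvP m n (I : 'I_m -> nat) (J : 'I_n -> nat)
    (M : btensor R I I) (P : btensor R J J) (A : btensor R I J) :
  herm_posdef M -> herm_posdef P -> is_wmpinv M P A (wmpinv M P A).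
Proof.
move=> hM hP; rewrite /wmpinv; case: xgetP => [//|noY].
by have [Y /noY] := is_wmpinv_exists A hM hP.
Qed.

Lemma wmpinv_eq m n (I : 'I_m -> nat) (J : 'I_n -> nat)
    (M : btensor R I I) (P : btensor R J J) (A : btensor R I J) Y :
  herm_posdef M -> herm_posdef P -> wmpinv M P A = Y <-> is_wmpinv M P A Y.
Proof.
move=> hM hP; have AP := wmpinvP A hM hP.
by split=> [<- //|]; exact: is_wmpinv_unique.
Qed.

(** [T] is the group inverse of [G], and [E = TG = GT]. Moving [F] past [G] in [TGF] and in [FGT]
    shows that [EF] and [FE] both equal [EFE]; doing so in [TFGT] gives [TFE = EFT]. *)
Lemma group_inverse_commute n (J : 'I_n -> nat) (G T E F : btensor R J J) :
    T *E G = E -> G *E T = E -> E *E G = G -> G *E E = G ->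
    T *E E = T -> E *E T = T -> F *E G = G *E F ->
  E *E F = F *E E /\ T *E F = F *E T.
Proof.
move=> TG GT EG GE TE ET FG.
have TFE : T *E F *E E = E *E F *E T.
  by rewrite -{1}GT einsteinA (einstein_mull FG) einsteinA TG.
have EF : E *E F = E *E F *E E.
  rewrite -[in LHS]TG (einstein_mull (esym FG)) -{1}GE !einsteinA.
  by rewrite (einstein_mull FG) einsteinA TG.
have FE : F *E E = E *E F *E E.
  rewrite -[in LHS]GT einsteinA FG -{1}EG -2!einsteinA (einsteinA G) -FG.
  by rewrite -einsteinA GT einsteinA.
split; first by rewrite EF -FE.
by rewrite -{1}TE -einsteinA EF -FE einsteinA TFE EF -FE -einsteinA ET.
Qed.

(** * Commutation relations behind the reverse-order law *)

Section ReverseOrder.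
Context {m n : nat} {I : 'I_m -> nat} {J : 'I_n -> nat}
  {M : btensor R I I} {P : btensor R J J} {A : btensor R I J}
  {Y : btensor R J I}.
Hypotheses (hM : herm_posdef M) (hP : herm_posdef P) (hY : is_wmpinv M P A Y).
Local Notation "A ^#" := (wadj P M A) (at level 2, format "A ^#").

Lemma wadj_gram : wadj P P (A^# *E A) = A^# *E A.
Proof. by rewrite (wadjM hM) (wadjK hM hP). Qed.

Lemma wmpinv_wadjl : Y *E A *E A^# = A^#.
Proof.
have /(is_wmpinvE hM hP)[AYA _ _ YAh] := hY.
by rewrite -YAh -(wadjM hP) einsteinA AYA.
Qed.

Lemma wmpinv_wadjr : A^# *E A *E Y = A^#.
Proof.
have /(is_wmpinvE hM hP)[AYA _ AYh _] := hY.
by rewrite -einsteinA -AYh -(wadjM hM) AYA.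
Qed.

Lemma commute_gram_wmpinv (F : btensor R J J) :
    wadj P P F = F -> F *E (A^# *E A) = A^# *E A *E F ->
  Y *E A *E F = F *E (Y *E A) /\ wadj M M (A *E F *E Y) = A *E F *E Y.
Proof.
move=> Fh FG; have /(is_wmpinvE hM hP)[AYA YAY AYh YAh] := hY.
(* T is the group inverse of A# A. *)
pose Y' := wadj M P Y; pose T := Y *E Y'.
have Th : wadj P P T = T by rewrite /T (wadjM hM) (wadjK hP hM).
have Y'A : Y' *E A^# = A *E Y by rewrite -(wadjM hP).
have AY' : A^# *E Y' = Y *E A by rewrite -(wadjM hM).
have TG : T *E (A^# *E A) = Y *E A.
  by rewrite /T einsteinA (einstein_mull Y'A) einsteinA YAY.
have GT : A^# *E A *E T = Y *E A.
  by rewrite /T einsteinA wmpinv_wadjr AY'.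
have ET : Y *E A *E T = T by rewrite /T einsteinA YAY.
have TE : T *E (Y *E A) = T.
  by rewrite -{1}Th -{1}YAh -(wadjM hP) ET Th.
have EG : Y *E A *E (A^# *E A) = A^# *E A.
  by rewrite einsteinA wmpinv_wadjl.
have GE : A^# *E A *E (Y *E A) = A^# *E A by rewrite einsteinA wmpinv_wadjr.
have [EF TF] := group_inverse_commute TG GT EG GE TE ET FG.
split=> //.
(* [Y = T A#], and [F T] is selfadjoint because [F] and [T] are selfadjoint and commute. *)
have -> : A *E F *E Y = A *E (F *E T) *E A^#.
  by rewrite /T !einsteinA (einstein_mull Y'A) -{1}YAY !einsteinA.
by rewrite -{1}TF !(wadjM hP) Th Fh (wadjK hM hP) einsteinA.
Qed.

End ReverseOrder.

(** [FGF] is selfadjoint, so [GF] equals its own adjoint [FG]. *)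
Lemma selfadj_commute n (J : 'I_n -> nat) (P F G : btensor R J J) :
    herm_posdef P -> wadj P P F = F -> wadj P P G = G ->
  F *E (G *E F) = G *E F -> F *E G = G *E F.
Proof.
move=> hP Fh Gh FGF; have := congr1 (wadj P P) FGF.
by rewrite !(wadjM hP) Fh Gh => <-; rewrite -einsteinA.
Qed.

(** The weighted Gram tensor of [GF - FGF] expands into terms which all equal [FGGF] by hypothesis,
    and they cancel. *)
Lemma selfadj_proj_gram n (J : 'I_n -> nat) (P F G : btensor R J J) :
    herm_posdef P -> wadj P P F = F -> wadj P P G = G -> F *E F = F ->
  F *E G *E F *E G = F *E G *E G -> G *E F = F *E G *E F.
Proof.
move=> hP Fh Gh FF FGFG.
apply/eqP; rewrite -subr_eq0; apply/eqP; apply: (wadj_gram_eq0 hP hP).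
rewrite wadjB !(wadjM hP) Gh Fh einsteinBr !einsteinBl !einsteinA.
by rewrite !(einstein_mull FF) FGFG !subrr.
Qed.

Lemma gram_wmpinv_proj m n l (I : 'I_m -> nat) (J : 'I_n -> nat)
    (K : 'I_l -> nat) (M : btensor R I I) (N : btensor R K K)
    (P : btensor R J J) (A : btensor R I J) (B : btensor R J K)
    (Y : btensor R J I) (X : btensor R K J) :
    herm_posdef M -> herm_posdef N -> herm_posdef P ->
    is_wmpinv M P A Y -> is_wmpinv P N B X ->
    is_wmpinv M N (A *E B) (X *E Y) ->
  B *E X *E (wadj P M A *E A *E B) = wadj P M A *E A *E B.
Proof.
move=> hM hN hP hY hX hXY.
have Gh := wadj_gram (A := A) hM hP.
have YAA := wmpinv_wadjl hM hP hY.
have /(is_wmpinvE hP hN)[BXB XBX BXh XBh] := hX.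
have ABXY := wmpinv_wadjr hM hN hXY.
set A' := wadj P M A in Gh YAA *; set G := A' *E A in Gh *.
set F := B *E X in BXh BXB *.
have FF : F *E F = F by rewrite /F einsteinA BXB.
(* Multiply [ABXY] on the left by the adjoint of [X]: its product with the adjoint of [B] is the
   adjoint of [F], that is [F]. *)
have FGFY : F *E G *E F *E Y = F *E A'.
  have := congr1 (einstein (wadj P N X)) ABXY.
  rewrite (wadjM hP) !einsteinA -(wadjM hN) BXh -/F -/A'.
  by rewrite (einstein_mull (erefl G)) (einstein_mull (erefl F)).
(* Multiplying on the right by [A A' A] removes [Y], because [Y A A' = A']. *)
have FGFG : F *E G *E F *E G = F *E G *E G.
  have := congr1 (fun Z => Z *E A *E A' *E A) FGFY.
  by rewrite (einstein_mulll YAA) -!(einsteinA _ A' A).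
have GF : G *E F = F *E G *E F by exact: (selfadj_proj_gram hP).
have := congr1 (fun Z => Z *E B) GF.
by rewrite !(einstein_mull BXB) -einsteinA => <-.
Qed.

End EinsteinAlgebra.

Theorem theorem13 (R : realType) (m n l : nat)
    (I : 'I_m -> nat) (J : 'I_n -> nat) (K : 'I_l -> nat)
    (A : btensor R I J) (B : btensor R J K)
    (M : btensor R I I) (N : btensor R K K) (P : btensor R J J)
    (hM : herm_posdef M) (hN : herm_posdef N) (hP : herm_posdef P) :
  wmpinv M N (A *E B) = wmpinv P N B *E wmpinv M P A
  <->
  trange (wctrans P M A *E A *E B) `<=` trange B /\
  trange (B *E wctrans N P B *E wctrans P M A) `<=` trange (wctrans P M A).
Proof.
rewrite !wctrans_wadj.
have hY := wmpinvP A hM hP; have hX := wmpinvP B hP hN.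
set Y := wmpinv M P A in hY *; set X := wmpinv P N B in hX *.
have hY' := is_wmpinv_wadj hM hP hY; have hX' := is_wmpinv_wadj hP hN hX.
have /(is_wmpinvE hM hP)[AYA YAY AYh YAh] := hY.
have /(is_wmpinvE hP hN)[BXB XBX BXh XBh] := hX.
have /(is_wmpinvE hP hM)[AYA' _ _ _] := hY'.
rewrite (wmpinv_eq _ _ hM hN) (trange_subP _ BXB) (trange_subP _ AYA').
split=> [hXY|[FGB EHA]].
  split; first exact: gram_wmpinv_proj hM hN hP hY hX hXY.
  (* Second inclusion: the reverse-order law passes to adjoints, so the first case applies to the
     adjoints of [B] and [A]. *)
  have := is_wmpinv_wadj hM hN hXY.
  rewrite (wadjM hP) (wadjM hP) => /(gram_wmpinv_proj hN hM hP hX' hY').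
  by rewrite (wadjK hP hN).
set F := B *E X in BXh; set E := Y *E A in YAh.
have AY' : wadj P M A *E wadj M P Y = E by rewrite -(wadjM hM).
(* [FGB] times [X] has the form [F G F = G F] required by [selfadj_commute]; for [EH] the multiplier
   is the adjoint of [Y]. *)
have FG : F *E (wadj P M A *E A) = wadj P M A *E A *E F.
  apply: (selfadj_commute hP BXh); first exact: wadj_gram.
  have := congr1 (fun Z => Z *E X) FGB.
  by rewrite -(einsteinA F) -!(einsteinA _ B X).
have EH : E *E (wadj P N (wadj N P B) *E wadj N P B) =
    wadj P N (wadj N P B) *E wadj N P B *E E.
  apply: (selfadj_commute hP YAh); first exact: wadj_gram.
  rewrite (wadjK hP hN) -AY'.
  have := congr1 (fun Z => Z *E wadj M P Y) EHA.
  by rewrite -(einsteinA (wadj P M A *E _)) -!(einsteinA _ _ (wadj M P Y)).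
have [EF AFYh] := commute_gram_wmpinv hM hP hY BXh FG.
have [_ BEXh] := commute_gram_wmpinv hN hP hX' YAh EH.
(* [BEXh] concerns the adjoint of this tensor, and selfadjointness passes back. *)
have XEBh : wadj N N (X *E E *E B) = X *E E *E B.
  have XEB : wadj N N (X *E E *E B) = wadj N P B *E E *E wadj P N X.
    by rewrite !(wadjM hP) YAh einsteinA.
  by apply: (can_inj (wadjK hN hN)); rewrite XEB.
apply/(is_wmpinvE hM hN).
have ABXY : A *E B *E (X *E Y) = A *E F *E Y by rewrite /F !einsteinA.
have XYAB : X *E Y *E (A *E B) = X *E E *E B by rewrite /E !einsteinA.
rewrite ABXY XYAB; split=> //.
  (* Swapping [F] and [E] leaves [(A Y A)(B X B)] here, and [(X B X)(Y A Y)] in the second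
     equation. *)
  have -> : A *E F *E Y *E (A *E B) = A *E (F *E E) *E B.
    by rewrite /F /E !einsteinA.
  by rewrite -EF /F !einsteinA AYA (einstein_mulll BXB).
have -> : X *E E *E B *E (X *E Y) = X *E (E *E F) *E Y.
  by rewrite /F /E !einsteinA.
by rewrite EF /F !einsteinA XBX (einstein_mulll YAY).
Qed.
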